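(* Define polynomials as follows. Let $$K_1(y,x_1,x_2,x_3)=\prod_{\varepsilon_1,\varepsilon_2,\varepsilon_3\in\{1,-1\}}\bigl(-y+\varepsilon_1\sqrt{x_1}+2\varepsilon_2\sqrt{x_2}+4\varepsilon_3\sqrt{x_3}\bigr),$$ which, after expansion, contains only even powers of $\sqrt{x_1},\sqrt{x_2},\sqrt{x_3}$ and hence is a polynomial in $y,x_1,x_2,x_3$ with integer coefficients of degree at most $8$ in $y$. Let $K_2(y,x_1,x_2,x_3,p,r)$ be the integer polynomial satisfying $K_2(y,x_1,x_2,x_3,p,r)=p^8\,K_1\!\left(y-\tfrac{r}{p},x_1,x_2,x_3\right)$ whenever $p\neq 0$ (obtained by writing $K_1(y-z,x_1,x_2,x_3)=\sum_{\alpha\le 8}c_\alpha(y,x_1,x_2,x_3)z^\alpha$ and setting $K_2=\sum_{\alpha\le 8}c_\alpha(y,x_1,x_2,x_3)\,p^{8-\alpha}r^{\alpha}$), and let $$K(y,x_1,x_2,x_3,p,r,n,v)=K_2(y-nv,x_1,x_2,x_3,p,r).$$ Let $x_1,x_2,x_3,p,r,n\in\mathbb{N}$ and $v\in\mathbb{Z}$ with $x_1$ odd, $x_2$ odd, $p>0$, and $n>\sqrt{x_1}+2\sqrt{x_2}+4\sqrt{x_3}+r$. Then there exists $y\in\mathbb{N}$ with $K(y,x_1,x_2,x_3,p,r,n,v)=0$ if and only if $x_1$, $x_2$ and $x_3$ are all squares of natural numbers, $p\mid r$, and $v\ge 0$. *)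

(* Defs.v *)
From mathcomp Require Import all_boot all_order all_algebra.
From mathcomp Require Import mpoly ring.

Set Implicit Arguments.
Unset Strict Implicit.
Unset Printing Implicit Defensive.

Import GRing.Theory Num.Theory.

Local Open Scope ring_scope.

(* In each polynomial ring the indeterminates are numbered in the order in
   which the arguments of the polynomial are listed:
     K1 (y, x1, x2, x3)   K2 (y, x1, x2, x3, p, r)
     K  (y, x1, x2, x3, p, r, n, v). *)

(* The defining product of K1, with indeterminates 'X_1, 'X_2, 'X_3 standing for
   the square roots of x1, x2, x3; a boolean e encodes the sign (-1) ^+ e. *)
Definition K1_sqrt : {mpoly int[4]} :=
  \prod_(e1 : bool) \prod_(e2 : bool) \prod_(e3 : bool)
    (- 'X_0 + (-1) ^+ e1 * 'X_1 + 2 * (-1) ^+ e2 * 'X_2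
       + 4 * (-1) ^+ e3 * 'X_3).

Definition halve_exponents (m : 'X_{1..4}) : 'X_{1..4} :=
  [multinom if i == ord0 then m i else (m i)./2 | i < 4].

(* The expanded product, rewritten in x1, x2, x3 instead of their square roots.
   K1_sqrt_even below shows that no odd exponent is lost by the halving. *)
Definition K1 : {mpoly int[4]} :=
  \sum_(m <- msupp K1_sqrt) K1_sqrt@_m *: 'X_[halve_exponents m].

(* K1(y - z, x1, x2, x3) as a univariate polynomial in z. *)
Definition K1_shift : {poly {mpoly int[4]}} :=
  mmap (polyC \o @mpolyC 4 int)
    (tnth [tuple ('X_0)%:P - 'X; ('X_1)%:P; ('X_2)%:P; ('X_3)%:P]) K1.

Definition K2 : {mpoly int[6]} :=
  \sum_(a < 9) (K1_shift`_a \mPo [tuple 'X_0; 'X_1; 'X_2; 'X_3])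
                 * 'X_4 ^+ (8 - a) * 'X_5 ^+ a.

Definition K : {mpoly int[8]} :=
  K2 \mPo [tuple 'X_0 - 'X_6 * 'X_7; 'X_1; 'X_2; 'X_3; 'X_4; 'X_5].

Definition flip_sign (i : 'I_4) : 4.-tuple {mpoly int[4]} :=
  [tuple (-1) ^+ (j == i) * 'X_j | j < 4].

Lemma K1_sqrt_flip (i : 'I_4) : i != 0 -> K1_sqrt \mPo flip_sign i = K1_sqrt.
Proof.
move=> i0.
have fE j : 'X_j \mPo flip_sign i = (-1) ^+ (j == i) * 'X_j.
  by rewrite comp_mpolyXU -tnth_nth tnth_mktuple.
rewrite /K1_sqrt !big_bool /= !rmorphM /= !rmorphD /= !rmorphN /= !rmorphM /=.
rewrite !rmorphXn /= !rmorphN1 !rmorph_nat !fE.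
have [|[|]] : i = 1 \/ i = 2 \/ i = 3.
- case: i i0 {fE} => [[|[|[|[|//]]]] //= h] _; [left | right; left | right; right]; exact/val_inj.
all: by move=> -> /=; ring.
Qed.

Lemma K1_sqrt_even (m : 'X_{1..4}) (i : 'I_4) :
  m \in msupp K1_sqrt -> i != 0 -> ~~ odd (m i).
Proof.
move=> mP i0; apply/negP => mi.
have XE m' : 'X_[m'] \mPo flip_sign i = (-1) ^+ (m' i) *: 'X_[m'].
  rewrite comp_mpolyX (mpolyXE_id int m').
  under eq_bigr => j _ do rewrite tnth_mktuple exprMn.
  rewrite big_split /= -mul_mpolyC; congr (_ * _).
  rewrite (bigD1 i) //= eqxx big1 ?mulr1 => [|j /negPf ->].
    by rewrite rmorphXn rmorphN1.
  by rewrite expr0 expr1n.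
have := congr1 (mcoeff m) (K1_sqrt_flip i0).
rewrite comp_mpolyEX raddf_sum /=.
under eq_bigr => k _ do rewrite XE.
rewrite /= (bigD1_seq m) ?msupp_uniq //= big1 => [|k /negPf km].
  rewrite !mcoeffZ mcoeffX eqxx mulr1 addr0 -signr_odd mi expr1 mulrN1.
  move: mP; rewrite mcoeff_msupp => /negP mP /eqP; rewrite -subr_eq0 -opprD.
  by rewrite oppr_eq0 -mulr2n mulrn_eq0 => /mP.
by rewrite !mcoeffZ mcoeffX km !mulr0.
Qed.

Lemma K1_sqrtE :
  K1 \mPo [tuple 'X_0; 'X_1 ^+ 2; 'X_2 ^+ 2; 'X_3 ^+ 2] = K1_sqrt.
Proof.
rewrite /K1 raddf_sum /= [RHS]mpolyE big_seq [RHS]big_seq.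
apply: eq_bigr => m mP; rewrite comp_mpolyZ comp_mpolyX [in RHS]mpolyXE_id.
congr (_ *: _); apply: eq_bigr => i _; rewrite mnmE (tnth_nth 0).
have := K1_sqrt_even mP (i := i).
case: i => [[|[|[|[|//]]]] h] /= ev; rewrite ?(eqP (isT : _ == _)) //.
all: rewrite -exprM mul2n even_halfK ?ev //.
all: by congr ('X_[mnm1 _] ^+ _); exact: val_inj.
Qed.

Lemma mmap_comp_mpoly (R : comNzRingType) (f : {rmorphism int -> R}) (n k : nat)
    (h : 'I_k -> R) (lq : n.-tuple {mpoly int[k]}) (p : {mpoly int[n]}) :
  mmap f h (p \mPo lq) = mmap f (fun i => mmap f h (tnth lq i)) p.
Proof.
rewrite comp_mpolyEX raddf_sum [RHS]/mmap; apply: eq_bigr => m _.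
rewrite /= mmapZ comp_mpolyX rmorph_prod; congr (_ * _).
by apply: eq_bigr => i _; rewrite rmorphXn.
Qed.

(* mmap intr (tnth v) q is the value of the integer polynomial q at the point v. *)
Lemma K1E (R : rcfType) (y x1 x2 x3 : R) : 0 <= x1 -> 0 <= x2 -> 0 <= x3 ->
  mmap intr (tnth [tuple y; x1; x2; x3]) K1 =
  \prod_(e1 : bool) \prod_(e2 : bool) \prod_(e3 : bool)
    (- y + (-1) ^+ e1 * Num.sqrt x1 + 2 * (-1) ^+ e2 * Num.sqrt x2
         + 4 * (-1) ^+ e3 * Num.sqrt x3).
Proof.
move=> x1_ge0 x2_ge0 x3_ge0.
pose h := tnth [tuple y; Num.sqrt x1; Num.sqrt x2; Num.sqrt x3].
transitivity (mmap (intr : int -> R) h K1_sqrt).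
  rewrite -K1_sqrtE mmap_comp_mpoly; apply: eq_bigr => m _; congr (_ * _).
  apply: eq_bigr => i _; congr (_ ^+ _); rewrite !(tnth_nth 0).
  case: i => [[|[|[|[|//]]]] hi] /=;
    by rewrite ?rmorphXn /= mmapX mmap1U /h (tnth_nth 0) /= ?sqr_sqrtr.
rewrite /K1_sqrt; do 3![rewrite rmorph_prod; apply: eq_bigr => ? _].
rewrite !rmorphD !rmorphN !rmorphM !rmorphXn !rmorphN1 !rmorph_nat /=.
by rewrite !mmapX !mmap1U.
Qed.

Lemma K1_sqrt_homog : K1_sqrt \is 8.-homog.
Proof.
pose F (e1 e2 e3 : bool) : {mpoly int[4]} :=
  - 'X_0 + (-1) ^+ e1 * 'X_1 + 2 * (-1) ^+ e2 * 'X_2 + 4 * (-1) ^+ e3 * 'X_3.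
have X i : ('X_i : {mpoly int[4]}) \is 1.-homog by rewrite dhomogX /= mdeg1.
have CX (c : int) i : c%:MP * 'X_i \is [in int[4], 1.-homog].
  by rewrite mul_mpolyC dhomogZ.
have FE e1 e2 e3 : F e1 e2 e3 \is 1.-homog.
  rewrite /F; have sE (e : bool) : (-1) ^+ e = ((-1) ^+ e)%:MP :> {mpoly int[4]}.
    by rewrite rmorphXn rmorphN1.
  have nE k : (k%:R : {mpoly int[4]}) = (k%:R)%:MP by rewrite rmorph_nat.
  by rewrite !sE !nE -!mpolyCM !dhomogD ?dhomogN ?CX ?X.
rewrite /K1_sqrt !big_bool -/(F _ _ _).
exact: (dhomogM (dhomogM (dhomogM (FE _ _ _) (FE _ _ _)) (dhomogM (FE _ _ _) (FE _ _ _)))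
  (dhomogM (dhomogM (FE _ _ _) (FE _ _ _)) (dhomogM (FE _ _ _) (FE _ _ _)))).
Qed.

Lemma size_K1_shift : (size K1_shift <= 9)%N.
Proof.
rewrite /K1_shift /K1 raddf_sum /= big_seq.
apply: (leq_trans (size_sum _ _ _)); apply/bigmax_leqP_seq => m _ mP.
have m0 : (m ord0 <= 8)%N.
  rewrite -(dhomog_mf K1_sqrt_homog mP) /= mdegE.
  by rewrite (bigD1 ord0) //= leq_addr.
rewrite mmapZ mmapX /mmap1 (bigD1 ord0) //= mnmE /=.
have [c ->] : exists c, \prod_(i < 4 | i != ord0)
    tnth [tuple ('X_0)%:P - 'X; ('X_1)%:P; ('X_2)%:P; ('X_3)%:P] i
      ^+ halve_exponents m i = c%:P :> {poly {mpoly int[4]}}.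
  apply: (big_ind (fun q => exists c, q = c%:P)).
  - by exists 1; rewrite polyC1.
  - by move=> _ _ [c ->] [d ->]; exists (c * d); rewrite polyCM.
  move=> i i0; exists ('X_i ^+ halve_exponents m i); rewrite rmorphXn /=.
  congr (_ ^+ _); rewrite (tnth_nth 0).
  by case: i i0 => [[|[|[|[|//]]]] hi] //= _; congr ('X_[mnm1 _])%:P; exact: val_inj.
rewrite mulrCA mulrA -mulrA -polyCM mulrC mul_polyC.
apply: (leq_trans (size_scale_leq _ _)); apply: (leq_trans (size_poly_exp_leq _ _)).
by rewrite (tnth_nth 0) /= -opprB size_polyN size_XsubC mul1n ltnS.
Qed.

Lemma rmorph_mmap (S T : comNzRingType) (g : {rmorphism S -> T})
    (f : {rmorphism int -> S}) (n : nat) (h : 'I_n -> S) (q : {mpoly int[n]}) :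
  g (mmap f h q) = mmap intr (fun i => g (h i)) q.
Proof.
rewrite rmorph_sum; apply: eq_bigr => m _; rewrite rmorphM rmorph_prod.
congr (_ * _); first by rewrite -[_@__]intz !rmorph_int.
by apply: eq_bigr => i _; rewrite rmorphXn.
Qed.

Lemma K2E (F : fieldType) (y x1 x2 x3 p r : F) : p != 0 ->
  mmap intr (tnth [tuple y; x1; x2; x3; p; r]) K2 =
  p ^+ 8 * mmap intr (tnth [tuple y - r / p; x1; x2; x3]) K1.
Proof.
move=> p0; pose h := tnth [tuple y; x1; x2; x3].
pose ev : {rmorphism {mpoly int[4]} -> F} := mmap intr h.
have -> : mmap intr (tnth [tuple y - r / p; x1; x2; x3]) K1
    = (map_poly ev K1_shift).[r / p].
  rewrite -[RHS]/((horner_eval (r / p) \o map_poly ev) K1_shift).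
  rewrite /K1_shift rmorph_mmap /mmap; apply: eq_bigr => m _; congr (_ * _).
  apply: eq_bigr => i _; congr (_ ^+ _); rewrite !(tnth_nth 0) /=.
  case: i => [[|[|[|[|//]]]] hi] /=; rewrite ?rmorphB /= ?map_polyC ?map_polyX /=;
  by rewrite /horner_eval ?hornerE mmapX mmap1U.
rewrite (@horner_coef_wide _ 9) ?(leq_trans (size_poly _ _)) ?size_K1_shift //.
rewrite /K2 rmorph_sum mulr_sumr; apply: eq_bigr => a _ /=.
rewrite !rmorphM !rmorphXn /= coef_map mmap_comp_mpoly !mmapX !mmap1U /=.
rewrite !(tnth_nth 0) /= expr_div_n -mulrA.
have -> : p ^+ 8 = p ^+ (8 - a) * p ^+ a by rewrite -exprD subnK // -ltnS.
rewrite [X in X * _](_ : _ = ev K1_shift`_a); last first.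
  rewrite /ev /=; apply: eq_bigr => m _; congr (_ * _).
  apply: eq_bigr => i _; congr (_ ^+ _); rewrite !(tnth_nth 0).
  by case: i => [[|[|[|[|//]]]] hi] /=; rewrite mmapX mmap1U /h !(tnth_nth 0).
have pa0 : p ^+ a != 0 by rewrite expf_neq0.
by field.
Qed.

Lemma KE (R : comNzRingType) (y x1 x2 x3 p r n v : R) :
  mmap intr (tnth [tuple y; x1; x2; x3; p; r; n; v]) K =
  mmap intr (tnth [tuple y - n * v; x1; x2; x3; p; r]) K2.
Proof.
rewrite /K mmap_comp_mpoly; apply: eq_bigr => m _; congr (_ * _).
apply: eq_bigr => i _; congr (_ ^+ _); rewrite !(tnth_nth 0).
by case: i => [[|[|[|[|[|[|//]]]]]] hi] /=; rewrite ?rmorphB ?rmorphM /= !mmapX !mmap1U.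
Qed.

(* Main.v *)
Require Import Defs.
From mathcomp Require Import all_boot all_order all_algebra.
From mathcomp Require Import mpoly reals.
From mathcomp Require Import ring lra zify.

(* K vanishes at y iff y - n v - r / p is one of the eight sums A + B + C, where
   A, B, C are the signed roots of x1, 4 x2, 16 x3. If such a sum is a rational
   number q then so is e2 = AB + BC + CA, hence so is e3 = ABC provided q <> 0,
   and C (C^2 + e2) = q C^2 + e3 with C^2 + e2 = (C + A) (C + B). Since x1 and x2
   are odd, q and the pairwise sums of A, B, C do not vanish, so C is rational,
   and by symmetry A and B too. The bound on n makes y negative when v < 0. *)

Set Implicit Arguments.
Unset Strict Implicit.
Unset Printing Implicit Defensive.

Import Order.TTheory GRing.Theory Num.Theory.

Local Open Scope ring_scope.

Lemma summand_in_subfield (F E : fieldType) (f : {rmorphism F -> E})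
    (a b c q : F) (A B C : E) :
  (2 : F) != 0 -> q != 0 -> C + A != 0 -> C + B != 0 ->
  A ^+ 2 = f a -> B ^+ 2 = f b -> C ^+ 2 = f c -> A + B + C = f q ->
  exists z : F, C = f z.
Proof.
move=> two0 q0 CA CB Aa Bb Cc ABCq.
have two0' : (2 : E) != 0 by rewrite -(rmorph_nat f) fmorph_eq0.
have q0' : A + B + C != 0 by rewrite ABCq fmorph_eq0.
have [e2 e2E] : exists e2, f e2 = A * B + B * C + C * A.
  (* Solved from [(A + B + C) ^+ 2 = A ^+ 2 + B ^+ 2 + C ^+ 2 + 2 * e2]. *)
  exists ((q ^+ 2 - a - b - c) / 2).
  rewrite rmorphM fmorphV !rmorphB rmorphXn /= -Aa -Bb -Cc -ABCq rmorph_nat.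
  by field.
have [e3 e3E] : exists e3, f e3 = A * B * C.
  (* Squaring [e2] leaves the cross terms [2 * (A * B * C) * (A + B + C)], whence the division by
     [2 * q]. *)
  exists ((e2 ^+ 2 - a * b - b * c - c * a) / (2 * q)).
  rewrite rmorphM fmorphV !rmorphB rmorphXn !rmorphM /=.
  rewrite -Aa -Bb -Cc -ABCq e2E rmorph_nat; field.
  by rewrite q0'.
exists ((q * c + e3) / (c + e2)).
rewrite rmorphM fmorphV !rmorphD rmorphM /= -Cc -ABCq e2E e3E.
have -> : C ^+ 2 + (A * B + B * C + C * A) = (C + A) * (C + B) by ring.
by apply: (canRL (mulfK (mulf_neq0 CA CB))); ring.
Qed.

(** The square of the denominator of [z] divides that of the numerator, so the denominator divides
    the numerator and [z] is an integer. *)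
Lemma sqr_nat_rat (x : nat) (z : rat) : z ^+ 2 = x%:R -> exists a : nat, x = (a ^ 2)%N.
Proof.
move=> zx; exists (`|numq z| %/ `|denq z|)%N.
have d0 : (0 < `|denq z|)%N by rewrite absz_gt0.
have E : (`|numq z| ^ 2 = x * `|denq z| ^ 2)%N.
  rewrite -!abszX -[x in RHS]/(`|x%:Z|%N) -abszM; congr absz.
  apply: (@intr_inj rat); rewrite rmorphXn intrM rmorphXn /=.
  have dz : (denq z)%:~R != 0 :> rat by rewrite intr_eq0 denq_eq0.
  rewrite (_ : x%:~R = ((numq z)%:~R / (denq z)%:~R) ^+ 2); last by rewrite divq_num_den.
  by field.
have /dvdnP[k kE] : (`|denq z| %| `|numq z|)%N.
  by rewrite -(@dvdn_pexp2r _ _ 2) // E dvdn_mull.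
by move: E; rewrite kE mulnK // expnMn => /eqP; rewrite eqn_pmul2r ?expn_gt0 ?d0 // => /eqP.
Qed.

(** Cast into [R], the integer value of [K] is the nonzero factor [p ^+ 8] times the eight factors
    of [K1], and the cast is injective. *)
Lemma K_eq0 (R : rcfType) (y x1 x2 x3 p r n : nat) (v : int) : (0 < p)%N ->
  K.@[tnth [tuple y%:Z; x1%:Z; x2%:Z; x3%:Z; p%:Z; r%:Z; n%:Z; v]] = 0 <->
  exists e1 e2 e3 : bool,
    y%:R - n%:R * v%:~R - r%:R / p%:R =
      (-1) ^+ e1 * Num.sqrt x1%:R + 2 * (-1) ^+ e2 * Num.sqrt x2%:R
        + 4 * (-1) ^+ e3 * Num.sqrt x3%:R :> R.
Proof.
move=> p_gt0; have p0 : p%:R != 0 :> R by rewrite pnatr_eq0 -lt0n.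
have KR : (K.@[tnth [tuple y%:Z; x1%:Z; x2%:Z; x3%:Z; p%:Z; r%:Z; n%:Z; v]])%:~R =
    mmap intr (tnth [tuple y%:R; x1%:R; x2%:R; x3%:R; p%:R; r%:R; n%:R; v%:~R]) K
      :> R.
  rewrite [LHS](rmorph_mmap intr) /mmap; apply: eq_bigr => m _; congr (_ * _).
  apply: eq_bigr => i _; congr (_ ^+ _); rewrite !(tnth_nth 0).
  by case: i => [[|[|[|[|[|[|[|[|//]]]]]]]] hi].
split=> [K0 | [e1 [e2 [e3 E]]]].
  move: KR; rewrite K0 KE K2E // K1E ?ler0n // => /esym/eqP.
  rewrite mulf_eq0 expf_eq0 (negPf p0) andbF /=.
  case/prodf_eq0=> e1 _ /prodf_eq0[e2 _ /prodf_eq0[e3 _ /eqP E0]].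
  exists e1, e2, e3; lra.
apply: (@intr_inj R); rewrite KR KE K2E // K1E ?ler0n //.
rewrite (bigD1 e1) //= (bigD1 e2) //= (bigD1 e3) //= {1}E.
have -> : forall a b c : R, - (a + b + c) + a + b + c = 0 by move=> *; ring.
by rewrite !mul0r mulr0.
Qed.

Lemma squares_of_rational_sum (R : rcfType) (x1 x2 x3 : nat) (A B C : R) (q : rat) :
  odd x1 -> odd x2 ->
  A ^+ 2 = x1%:R -> B ^+ 2 = (4 * x2)%:R -> C ^+ 2 = (16 * x3)%:R ->
  A + B + C = ratr q ->
  [/\ exists a : nat, x1 = (a ^ 2)%N,
      exists a : nat, x2 = (a ^ 2)%N &
      exists a : nat, x3 = (a ^ 2)%N].
Proof.
move=> x1_odd x2_odd Ax Bx Cx ABCq.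
have sum_neq0 (X Y : R) (i j : nat) : X ^+ 2 = i%:R -> Y ^+ 2 = j%:R ->
    i <> j -> X + Y != 0.
  move=> Xi Yj ij; apply/eqP => /eqP; rewrite addr_eq0 => /eqP XY; apply: ij.
  by apply/eqP; rewrite -(eqr_nat R) -Xi -Yj XY sqrrN.
(* The squares [x1], [4 * x2], [16 * x3] are pairwise distinct: the first is odd, and [x2 = 4 * x3]
   would make [x2] even. *)
have AB : A + B != 0 by apply: sum_neq0 Ax Bx _; lia.
have BC : B + C != 0 by apply: sum_neq0 Bx Cx _; lia.
have CA : C + A != 0 by apply: sum_neq0 Cx Ax _; lia.
(* If A + B + C = 0 then (A^2 + B^2 + C^2)^2 = 4 (A^2 B^2 + B^2 C^2 + C^2 A^2). *)
have q0 : q != 0.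
  apply/eqP => q0; have CE : C = - (A + B) by move: ABCq; rewrite q0 raddf0; lra.
  have : ((x1 + 4 * x2 + 16 * x3) ^ 2
      = 4 * (x1 * (4 * x2) + 4 * x2 * (16 * x3) + 16 * x3 * x1))%N.
    move: Bx Cx; move: (4 * x2)%N (16 * x3)%N => y2 y3 By Cy.
    apply/eqP; rewrite -(eqr_nat R) natrX natrM !natrD !natrM -Ax -By -Cy CE.
    by apply/eqP; ring.
  (* The left side is odd because [x1] is, while the right side is a multiple of 4. *)
  move/(congr1 odd); rewrite oddX !oddM !oddD !oddM x1_odd x2_odd.
  by case: (odd x3).
have summand (X Y Z : R) (i j k : nat) : X ^+ 2 = i%:R -> Y ^+ 2 = j%:R ->
    Z ^+ 2 = k%:R -> Z + X != 0 -> Z + Y != 0 -> X + Y + Z = ratr q ->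
    exists z, Z = ratr z.
  move=> Xi Yj Zk ZX ZY XYZq.
  by apply: (@summand_in_subfield _ _ ratr i%:R j%:R k%:R q X Y Z);
    rewrite //= ratr_nat.
(* Here [k] is the coefficient 1, 2 or 4 of the root; dividing by it makes [m] the square of the
   rational [z / k]. *)
have sq (X : R) (k m : nat) (z : rat) : (0 < k)%N -> X = ratr z ->
    X ^+ 2 = (k ^ 2 * m)%:R -> exists a : nat, m = (a ^ 2)%N.
  move=> k_gt0 -> zm; apply: (@sqr_nat_rat m (z / k%:R)).
  apply: (@fmorph_inj _ _ (ratr : rat -> R)).
  rewrite rmorphXn fmorph_div /= !ratr_nat expr_div_n zm natrM natrX.
  by rewrite mulrC mulKf // expf_neq0 // pnatr_eq0 -lt0n.
split.
- have [] := summand _ _ _ _ _ _ Bx Cx Ax; rewrite // -?ABCq; [by rewrite addrC | by ring |].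
  by move=> z zE; apply: (sq A 1 _ z); rewrite ?mul1n.
- have [] := summand _ _ _ _ _ _ Cx Ax Bx; rewrite // -?ABCq; [by rewrite addrC | by ring |].
  by move=> z zE; apply: (sq B 2 _ z).
- have [] := summand _ _ _ _ _ _ Ax Bx Cx; [by [] | by rewrite addrC | by [] |].
  by move=> z zE; apply: (sq C 4 _ z).
Qed.

Theorem theorem5 (R : realType) (x1 x2 x3 p r n : nat) (v : int)
    (x1_odd : odd x1) (x2_odd : odd x2) (p_gt0 : (0 < p)%N)
    (n_gt : Num.sqrt (x1%:R : R) + 2 * Num.sqrt (x2%:R : R)
              + 4 * Num.sqrt (x3%:R : R) + r%:R < n%:R) :
  (exists y : nat,
     K.@[tnth [tuple y%:Z; x1%:Z; x2%:Z; x3%:Z; p%:Z; r%:Z; n%:Z; v]] = 0)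
  <->
  [/\ exists a : nat, x1 = (a ^ 2)%N,
      exists a : nat, x2 = (a ^ 2)%N,
      exists a : nat, x3 = (a ^ 2)%N,
      (p %| r)%N & 0 <= v].
Proof.
have p0 : p%:R != 0 :> R by rewrite pnatr_eq0 -lt0n.
have sqrtX (a : nat) : Num.sqrt (a ^ 2)%:R = a%:R :> R.
  by rewrite natrX sqrtr_sqr ger0_norm.
split=> [[y /(K_eq0 R _ _ _ _ _ _ _ p_gt0)[e1 [e2 [e3 E]]]] |].
  have [] := @squares_of_rational_sum R x1 x2 x3 ((-1) ^+ e1 * Num.sqrt x1%:R)
    (2 * (-1) ^+ e2 * Num.sqrt x2%:R) (4 * (-1) ^+ e3 * Num.sqrt x3%:R)
    (y%:R - n%:R * v%:~R - r%:R / p%:R) x1_odd x2_odd.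
  - by rewrite exprMn sqrr_sign sqr_sqrtr ?ler0n ?mul1r.
  - by rewrite !exprMn sqrr_sign sqr_sqrtr ?ler0n // mulr1 natrM; ring.
  - by rewrite !exprMn sqrr_sign sqr_sqrtr ?ler0n // mulr1 natrM; ring.
  - by rewrite -E !rmorphB !rmorphM fmorphV /= !ratr_nat ratr_int.
  move=> [a x1E] [b x2E] [c x3E]; split; [by exists a|by exists b|by exists c| |].
    (* By [E] this integer equals [r / p]. *)
    pose s : int := y%:Z - n%:Z * v - ((-1) ^+ e1 * a%:Z + 2 * (-1) ^+ e2 * b%:Z
      + 4 * (-1) ^+ e3 * c%:Z).
    have rE : r%:Z = s * p%:Z.
      apply: (@intr_inj R).
      rewrite rmorphM /= -[r%:~R](divfK p0); congr (_ * _).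
      rewrite !rmorphB !rmorphD !rmorphM !rmorphXn !rmorphN1 /=.
      move: E; rewrite x1E x2E x3E !sqrtX; lra.
    by move: (dvdz_mull s (dvdzz p)); rewrite -rE.
  rewrite leNgt; apply/negP => v_lt0.
  (* Since [v] is an integer, [n * v <= - n]; with [r / p <= r] and every sign replaced by plus,
     [n_gt] forces [y < 0]. *)
  have vR : (v%:~R : R) <= -1 by rewrite -mulrN1z ler_int; lia.
  have rp : 0 <= (r%:R : R) / p%:R <= r%:R.
    rewrite divr_ge0 ?ler0n //= ler_pdivrMr ?ltr0n //.
    by rewrite ler_peMr ?ler0n // ler1n.
  have sign_le (e : bool) (z : R) : 0 <= z -> (-1) ^+ e * z <= z by case: e => /=; lra.
  have := sign_le e1 _ (sqrtr_ge0 (x1%:R : R)).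
  have := sign_le e2 _ (sqrtr_ge0 (x2%:R : R)).
  have := sign_le e3 _ (sqrtr_ge0 (x3%:R : R)).
  have nv : (n%:R : R) * v%:~R <= - n%:R by rewrite -mulrN1 ler_wpM2l.
  move: E rp (ler0n R y); rewrite -!mulrA; lra.
move=> [[a x1E] [b x2E] [c x3E] /dvdnP[k rE] v_ge0].
(* The root of the factor with all signs positive, where [k = r / p]; it is a natural number because
   [v] is nonnegative. *)
exists (n * `|v| + k + a + 2 * b + 4 * c)%N.
apply/(K_eq0 R _ _ _ _ _ _ _ p_gt0); exists false, false, false.
rewrite x1E x2E x3E !sqrtX rE natrM mulfK // !natrD !natrM.
by rewrite natr_absz ger0_norm //; ring.
Qed.
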